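(* For every integer $d\ge 2$ there is a constant $C$ depending only on $d$ such that the following holds: if $f\in\mathbb{C}[w,z]$ is a polynomial of degree $d$ with no linear factor (no factor of degree $1$), then for every positive integer $k$ and every $k\times k$ grid in $\mathbb{C}^2$, the complex plane algebraic curve $\{(w,z)\in\mathbb{C}^2 : f(w,z)=0\}$ does not contain more than $Ck^{2/3}$ points from the grid.
   Context: An arithmetic progression of length $k$ in $\mathbb{C}$ consists of the points $\alpha+j\beta$, $j=0,1,\dots,k-1$, with $\alpha,\beta\in\mathbb{C}$. A $k\times k$ grid in $\mathbb{C}^2$ is the cartesian product of two arithmetic progressions of length $k$ in $\mathbb{C}$, i.e. a set $\{\alpha+i\beta : 0\le i\le k-1\}\times\{\gamma+j\delta : 0\le j\le k-1\}$ with $\alpha,\beta,\gamma,\delta\in\mathbb{C}$ (here $i,j$ are integer indices). *)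

(* Defs.v *)
From mathcomp Require Import all_boot all_order all_algebra.
From mathcomp Require Import finmap mpoly.

Set Implicit Arguments.
Unset Strict Implicit.
Unset Printing Implicit Defensive.

Import GRing.Theory.
Local Open Scope fset_scope.
Local Open Scope ring_scope.

(* The common difference may be zero, in which case the progression, as a set
   of points, has a single element. *)
Definition arith_prog (F : nzRingType) (k : nat) (a b : F) : {fset F} :=
  [fset a + j%:R * b | j in iota 0 k].

Definition grid (F : nzRingType) (k : nat) (a b c e : F) : {fset F * F} :=
  arith_prog k a b `*` arith_prog k c e.

Definition eval2 (F : comNzRingType) (f : {mpoly F[2]}) (p : F * F) : F :=
  f.@[tnth [tuple p.1; p.2]].

Definition curve_points (F : comNzRingType) (f : {mpoly F[2]})
    (A : {fset F * F}) : {fset F * F} :=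
  [fset p in A | eval2 f p == 0].

(* [msize] is one more than the total degree, and [msize 0 = 0]. *)
Definition has_degree (F : nzRingType) (n : nat) (f : {mpoly F[n]}) (d : nat) :
    Prop :=
  msize f = d.+1.

Definition has_linear_factor (F : comNzRingType) (n : nat) (f : {mpoly F[n]}) :
    Prop :=
  exists g h : {mpoly F[n]}, has_degree g 1 /\ f = g * h.

(* Main.v *)
(* For nonzero steps an affine change of variables turns the grid into integer
   points of [0, k)^2 (a zero step may be replaced by 1), and we may assume the
   curve irreducible.  If [N] grid points lie on it, choose a prime [p] of order
   [N].  The monomial matrix of the points has rank at most its complex rank
   modulo [p], so the points lie modulo [p] on a nonzero curve of the same
   degree and fall into only [O(p)] residue classes; by Cauchy-Schwarz at least
   about [N^2 / p] pairs of points are congruent modulo [p].  A difference of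
   congruent points takes [O((k / p)^2)] values, and each nonzero value occurs
   [O(1)] times: an irreducible curve that is not a line has finitely many
   points in common with a proper translate.  Hence [N^2 / p = O((k / p)^2)],
   that is [N^3 = O(k^2)]. *)
Require Import Defs.
From HB Require Import structures.
From mathcomp Require Import all_boot all_order all_algebra.
From mathcomp Require Import zify ring.
From Stdlib Require Import Classical.

Set Implicit Arguments.
Unset Strict Implicit.
Unset Printing Implicit Defensive.

(** * Primes between powers of 4 *)

Definition primorial n := \prod_(0 <= p < n.+1 | prime p) p.

Lemma prod_primes_dvdn a b N :
  (forall p, a <= p < b -> prime p -> p %| N) ->
  \prod_(a <= p < b | prime p) p %| N.
Proof.
elim: b => [|b IHb] dvdN; first by rewrite big_geq.
have [ltba|leab] := ltnP b a; first by rewrite big_geq.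
rewrite big_mkcond big_nat_recr //= -big_mkcond /=.
have IH: \prod_(a <= p < b | prime p) p %| N.
  by apply: IHb => p /andP[lap ltpb]; apply: dvdN; rewrite lap ltnW.
case: ifP => [prb|_]; last by rewrite muln1.
rewrite Gauss_dvd ?IH ?dvdN ?leab ?leqnn //.
rewrite coprime_sym prime_coprime //.
rewrite Euclid_dvd_prod // big_nat_cond big_has_cond; apply/negP; case/hasP=> p _.
by case/andP=> /andP[/andP[_ ltpb] prp]; rewrite dvdn_prime2 // gtn_eqF.
Qed.

Lemma central_bin_fact m : 'C(m.*2, m) * (m`! * m`!) = (m.*2)`!.
Proof. by have := @bin_fact m.*2 m; rewrite -addnn leq_addl addnK => <-. Qed.

Lemma central_bin_ub m : 'C(m.*2, m) <= 4 ^ m.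
Proof.
rewrite -[4]/(2 ^ 2) -expnM mul2n -[2]/(1 + 1) expnDn.
have lt_m : m < m.*2.+1 by lia.
by rewrite (bigD1 (Ordinal lt_m)) //= !exp1n !muln1 leq_addr.
Qed.

Lemma central_bin_lb m : 2 ^ m <= 'C(m.*2, m).
Proof.
elim: m => [|m IHm]; first by rewrite bin0.
rewrite doubleS binS expnS.
have le_bin : 'C(m.*2, m) <= 'C(m.*2.+1, m).
  by case: (m) => [|n]; rewrite ?bin0 // binS leq_addr.
have -> : 'C(m.*2.+1, m.+1) = 'C(m.*2.+1, m).
  by rewrite -[RHS]bin_sub; [congr 'C(_, _); lia|lia].
by lia.
Qed.

(** The primes in (m, 2m] divide (2m)! but not m!, so their product divides the central binomial
    coefficient, which is at most 4^m. *)
Lemma primorial_double m : primorial m.*2 <= primorial m * 4 ^ m.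
Proof.
rewrite /primorial (@big_cat_nat _ _ _ m.+1) //=; last by lia.
rewrite leq_mul2l; apply/orP; right; apply: leq_trans (central_bin_ub m).
apply: dvdn_leq; first by rewrite bin_gt0; lia.
apply: prod_primes_dvdn => p /andP[ltmp lepm] prp.
have : p %| (m.*2)`! by rewrite dvdn_fact // prime_gt0.
rewrite -central_bin_fact !Euclid_dvdM //.
have: ~~ (p %| m`!).
  apply/negP; rewrite fact_prod Euclid_dvd_prod // => /=.
  rewrite big_nat_cond big_has_cond; case/hasP => i.
  rewrite mem_index_iota => ? /andP[_ /dvdn_leq]; lia.
by move/negbTE->; rewrite !orbF.
Qed.

Lemma primorial_exp2 s : primorial (2 ^ s) <= 4 ^ (2 ^ s).
Proof.
elim: s => [|s IHs]; first by rewrite /primorial unlock.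
rewrite expnS mul2n; apply: leq_trans (primorial_double _) _.
by rewrite -addnn expnD leq_mul2r IHs orbT.
Qed.

Lemma sum_leq_threshold t n : \sum_(1 <= k < n) (k <= t) <= t.
Proof.
suff: \sum_(1 <= k < n) (k <= t) <= minn t n.-1 by lia.
elim: n => [|[|n] IHn]; [by rewrite big_geq|by rewrite big_geq|].
by rewrite big_nat_recr //=; case: leqP; lia.
Qed.

(** By Legendre's formula the exponent of p is the sum over k of floor(2m / p^k) - 2 floor(m / p^k).
    Each term is at most 1 and vanishes once p^k > 2m. *)
Lemma logn_central_bin p m : prime p -> 0 < m ->
  p ^ logn p 'C(m.*2, m) <= m.*2.
Proof.
move=> prp m_gt0; have p_gt1 := prime_gt1 prp.
suff le_log: logn p 'C(m.*2, m) <= trunc_log p m.*2.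
  apply: leq_trans (trunc_logP p_gt1 _); last by rewrite double_gt0.
  by rewrite leq_exp2l.
apply: leq_trans (sum_leq_threshold _ m.*2.+1).
have bin_pos : 0 < 'C(m.*2, m) by rewrite bin_gt0; lia.
have /(congr1 (logn p)) := central_bin_fact m.
rewrite !lognM ?muln_gt0 ?fact_gt0 // !logn_fact // => eq_log.
have eq_sum : \sum_(1 <= k < m.+1) m %/ p ^ k = \sum_(1 <= k < m.*2.+1) m %/ p ^ k.
  rewrite [RHS](@big_cat_nat _ _ _ m.+1) /=; [|lia|lia].
  rewrite -[LHS]addn0; congr (_ + _); rewrite big_nat_cond big1 // => k /andP[/andP[ltmk _] _].
  by rewrite divn_small // (ltn_trans ltmk) // ltn_expl.
rewrite eq_sum in eq_log.
rewrite -(leq_add2r (\sum_(1 <= k < m.*2.+1) m %/ p ^ k + \sum_(1 <= k < m.*2.+1) m %/ p ^ k)).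
rewrite eq_log -!big_split /=; apply: leq_sum => k _.
have q_gt0 : 0 < p ^ k by rewrite expn_gt0 prime_gt0.
have [le_q|lt_q] := leqP (p ^ k) m.*2.
  by rewrite trunc_log_max //; nia.
by rewrite divn_small //.
Qed.

Lemma central_bin_prod m : 0 < m ->
  'C(m.*2, m) = \prod_(0 <= p < m.*2.+1 | prime p) p ^ logn p 'C(m.*2, m).
Proof.
move=> m_gt0; set N := 'C(_, _).
have N_gt0 : 0 < N by rewrite bin_gt0; lia.
have pi_le p : prime p -> p %| N -> p <= m.*2.
  move=> prp dvd_p; have : p %| (m.*2)`! by rewrite -central_bin_fact dvdn_mulr.
  rewrite fact_prod Euclid_dvd_prod // big_nat_cond big_has_cond; case/hasP => i.
  by rewrite mem_index_iota => ? /andP[_ /dvdn_leq]; lia.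
rewrite -[LHS](partnT N_gt0) (widen_partn _ (leq_addl m.*2 N)) /=.
rewrite (@big_cat_nat _ _ _ m.*2.+1) //=; last by lia.
rewrite [X in _ * X]big_nat_cond [X in _ * X]big1 ?muln1.
  rewrite big_mkcond [RHS]big_mkcond; apply: eq_bigr => p _ /=.
  by case: ifP => // /negbT npr; rewrite /logn (negbTE npr).
move=> p /andP[/andP[ltp _] _].
rewrite lognE; case: ifP => // /and3P[prp _ /pi_le]; lia.
Qed.

(** A weak Bertrand postulate by Erdős's argument on the binomial coefficient of (2m, m) with 2m =
    4^s. If no prime lies in (n, 2m], the primes up to r = sqrt(2m) contribute at most 2m each, and
    those in (r, n] at most the primorial of n. *)
Lemma exists_prime_pow4 s : 5 <= s ->
  exists2 p, prime p & 4 ^ (s - 2) < p <= 4 ^ s.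
Proof.
move=> s_ge5; pose m := 2 ^ s.*2.-1; pose n := 4 ^ (s - 2); pose r := 2 ^ s.
have def4 t : 4 ^ t = 2 ^ t.*2 by rewrite -mul2n expnM.
have m2E : m.*2 = 4 ^ s by rewrite -mul2n -expnS def4; congr (2 ^ _); lia.
have m_gt0 : 0 < m by rewrite expn_gt0.
have sqr_r : r * r = m.*2 by rewrite m2E def4 -expnD addnn.
have nE : n = 2 ^ (s - 2).*2 by rewrite /n def4.
have le_rn : r <= n by rewrite nE leq_exp2l //; lia.
have le_nm : n <= m.*2 by rewrite m2E leq_exp2l //; lia.
case: (boolP (has prime (index_iota n.+1 m.*2.+1))) => [/hasP[p]|/hasPn no_prime].
  by rewrite mem_index_iota m2E ltnS => ? ?; exists p.
(* In exponents of 2 this reads 4^s / 2 <= 2s (2^s + 1) + 4^s / 8, which is false from s = 5 on (512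
   against 458). *)
exfalso; suff : 2 ^ m <= (m.*2) ^ r.+1 * 4 ^ n.
  rewrite m2E !def4 -expnM -expnD leq_exp2l // /m nE /r.
  have [t ->] : exists t, s = t.+4.+1 by exists (s - 5); lia.
  have u_ge : 8 * t.+1 <= 2 ^ t.+3 by elim: t => // t IHt; rewrite expnS; lia.
  have -> : t.+4.+1 - 2 = t.+3 by lia.
  have -> : (t.+4.+1).*2.-1 = 3 + (t.+3 + t.+3) by lia.
  rewrite (expnS 2 t.+4) (expnS 2 t.+3) -!addnn !expnD; move: u_ge.
  by move: (2 ^ t.+3) => u; nia.
apply: leq_trans (central_bin_lb m) _; rewrite central_bin_prod //.
rewrite (@big_cat_nat _ _ _ n.+1) //= [X in _ * X]big_nat_cond.
rewrite [X in _ * X]big1 ?muln1; last first.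
  move=> p /andP[p_range prp]; have := no_prime p.
  by rewrite mem_index_iota prp => /(_ p_range).
rewrite (@big_cat_nat _ _ _ r.+1) //=.
apply: leq_mul.
  rewrite -[X in _ ^ X]subn0 -prod_nat_const_nat big_mkcond /=.
  apply: leq_prod => p _; case: ifP => [prp|_]; first exact: logn_central_bin.
  by rewrite m2E expn_gt0.
apply: leq_trans (_ : primorial n <= _); last by rewrite nE; apply: primorial_exp2.
rewrite /primorial [X in _ <= X](@big_cat_nat _ _ _ r.+1) //=.
apply: leq_trans (leq_pmull _ _); last first.
  by apply: prodn_cond_gt0 => p; apply: prime_gt0.
rewrite big_nat_cond [X in _ <= X]big_nat_cond; apply: leq_prod => p /andP[/andP[lt_rp _] prp].
(* A prime above r occurs at most once, since its square exceeds r^2 = 2m. *)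
have := logn_central_bin prp m_gt0; case: (logn _ _) => [|[|e]].
- by move=> _; apply: prime_gt0.
- by rewrite expn1.
by rewrite !expnS -sqr_r => le_r; have : 0 < p ^ e; [rewrite expn_gt0 prime_gt0|nia].
Qed.

Import GRing.Theory Num.Theory.
Local Open Scope ring_scope.

(** * Bivariate polynomials and their translates *)

Lemma card_le_fibers (T U : finType) (g : T -> U) (A : {set T}) (B : {set U}) n :
    (forall t, t \in A -> g t \in B) ->
    (forall u, u \in B -> #|[set t in A | g t == u]| <= n)%N ->
  (#|A| <= #|B| * n)%N.
Proof.
move=> AB fib; rewrite -sum_nat_const.
rewrite -sum1_card (partition_big g (mem B)) //=; apply: leq_sum => u /fib.
by rewrite -sum1_card; under eq_bigl do rewrite inE.
Qed.

Lemma card_le_rows (I J : finType) (A : {set I * J}) (B : {set J}) n :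
    (forall P, P \in A -> P.2 \in B) ->
    (forall j, j \in B -> #|[set i | (i, j) \in A]| <= n)%N ->
  (#|A| <= #|B| * n)%N.
Proof.
move=> AB rows; apply: (card_le_fibers (g := snd)) => // j /rows; apply: leq_trans.
rewrite -[leqRHS](card_imset _ (f := fun i => (i, j))); last by move=> i i' [].
apply/subset_leq_card/subsetP => -[i j']; rewrite inE => /andP[iA /eqP /= ej].
by rewrite {}ej in iA *; apply/imsetP; exists i; rewrite ?inE.
Qed.

Lemma card_roots_le (K : idomainType) (T : finType) (h : T -> K) (p : {poly K}) n :
    injective h -> p != 0 -> (size p <= n.+1)%N ->
  (#|[set t | p.[h t] == 0%R]| <= n)%N.
Proof.
move=> h_inj p_nz szp; rewrite -ltnS; apply: leq_trans szp.
rewrite cardE -(size_map h) max_poly_roots ?map_uniq ?(map_inj_uniq h_inj) ?enum_uniq //.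
by apply/allP => x /mapP[t]; rewrite mem_enum inE /root => pt0 ->.
Qed.

Lemma poly_eq0_progression (K : numDomainType) (p : {poly K}) (a v : K) :
  v != 0 -> (forall n, p.[a + n%:R * v] = 0) -> p = 0.
Proof.
move=> v_nz p0; apply/eqP/contraT => p_nz.
pose h (i : 'I_(size p).+1) := a + i%:R * v.
have h_inj : injective h.
  by move=> i j /addrI /(mulIf v_nz) /eqP; rewrite eqr_nat => /eqP/val_inj.
have := card_roots_le h_inj p_nz (leqnSn _).
rewrite (_ : [set _ | _] = setT) ?cardsT ?card_ord ?ltnn //.
by apply/setP => i; rewrite !inE p0 eqxx.
Qed.

Section BivariateDivisibility.
Variable K : closedFieldType.
Implicit Types F G H q g u : {poly {poly K}}.

(** The hypothesis says that u vanishes on the horizontal line at height y. Swapping the variables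
    reduces this to the factor theorem. *)
Lemma divides_horizontal u (y : K) : map_poly (horner_eval y) u = 0 ->
  exists v, u = ('X - y%:P) *: v.
Proof.
rewrite -horner_swapXY => /eqP; rewrite -/(root _ _) => /factor_theorem[v def_u].
exists (swapXY v); rewrite -[u]swapXYK def_u rmorphM rmorphB /= swapXY_X.
by rewrite swapXY_polyC map_polyC /= -polyCB mulrC mul_polyC.
Qed.

(* Gauss's lemma: a root of the content [c] is removed from one of the two
   factors at a time. *)
Lemma gauss_split (c : {poly K}) F q g : c != 0 -> c *: F = q * g ->
  exists a b q' g', [/\ F = q' * g', q = a *: q' & g = b *: g'].
Proof.
have [n] := ubnP (size c); elim: n => // n IHn in c q g *; rewrite ltnS.
move=> sz_c c_nz eqF; have [/eqP/size_poly1P[k k_nz def_c]|] := eqVneq (size c) 1%N.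
  exists k%:P, 1, (k^-1%:P *: q), g; split; rewrite ?scale1r //.
    by rewrite -scalerAl -eqF def_c scalerA -polyCM mulVf // scale1r.
  by rewrite scalerA -polyCM mulfV // scale1r.
case/closed_rootP => y /factor_theorem[c1 def_c].
have c1_nz : c1 != 0 by apply: contraNneq c_nz => c1_0; rewrite def_c c1_0 mul0r.
have sz_c1 : (size c1 < n)%N.
  by move: sz_c; rewrite def_c size_Mmonic ?monicXsubC // size_XsubC addn2.
have l_nz : 'X - y%:P != 0 :> {poly K} by rewrite polyXsubC_eq0.
have : map_poly (horner_eval y) (q * g) = 0.
  rewrite -eqF -mul_polyC rmorphM /= map_polyC /= /horner_eval def_c.
  by rewrite hornerM !hornerE subrr mulr0 mul0r.
rewrite rmorphM => /eqP; rewrite mulf_eq0.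
case/orP=> /eqP/divides_horizontal[v def_v].
  have /(IHn c1 _ _ sz_c1 c1_nz) : c1 *: F = v * g.
    apply: (@mulfI _ ('X - y%:P)%:P); first by rewrite polyC_eq0.
    by rewrite !mul_polyC scalerA mulrC -def_c eqF def_v scalerAl.
  case=> a [b [q' [g' [-> def_q ->]]]].
  by exists (('X - y%:P) * a), b, q', g'; rewrite def_v def_q scalerA.
have /(IHn c1 _ _ sz_c1 c1_nz) : c1 *: F = q * v.
  apply: (@mulfI _ ('X - y%:P)%:P); first by rewrite polyC_eq0.
  by rewrite !mul_polyC scalerA mulrC -def_c eqF def_v scalerAr.
case=> a [b [q' [g' [-> -> def_g]]]].
by exists a, (('X - y%:P) * b), q', g'; rewrite def_v def_g scalerA.
Qed.

(* In [{poly {poly K}}] the outer variable is the first coordinate. *)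
Definition line (a b c : K) : {poly {poly K}} := a%:P *: 'X + (b *: 'X + c%:P)%:P.

Definition line_free F := forall a b c H, F = line a b c * H -> a = 0 /\ b = 0.

(** Sizes at most 1 in both variables mean a constant. Constants and zero also qualify: only a
    splitting into two nonconstant factors is excluded. *)
Definition bivar_irreducible F := forall G H, F = G * H ->
  (size G <= 1 /\ sizeY G <= 1)%N \/ (size H <= 1 /\ sizeY H <= 1)%N.

Lemma line_free_neq0 F : line_free F -> F != 0.
Proof.
move=> lfF; apply/eqP => F0; case: (lfF 1 0 0 0); rewrite ?mulr0 //.
by move/eqP; rewrite oner_eq0.
Qed.

Lemma line_free_horizontal F y : line_free F -> map_poly (horner_eval y) F != 0.
Proof.
move=> lfF; apply/eqP => /divides_horizontal[v]; rewrite -mul_polyC => def_F.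
case: (lfF 0 1 (- y) v); first by rewrite /line scale0r add0r scale1r polyCN.
by move=> _ /eqP; rewrite oner_eq0.
Qed.

(** The value is the restriction of F to the line x = by + c; were it zero, the factor theorem over
    the coefficient ring would split off that line. *)
Lemma line_free_graph F b c : line_free F -> F.[b *: 'X + c%:P] != 0.
Proof.
move=> lfF; apply/negP; rewrite -/(root _ _) => /factor_theorem[v]; rewrite mulrC => def_F.
case: (lfF 1 (- b) (- c) v); last by move/eqP; rewrite oner_eq0.
by rewrite def_F /line scale1r scaleNr polyCN -opprD polyCN.
Qed.

Lemma line_free_size F x y : line_free F -> F.[x, y] = 0 -> (1 < size F)%N.
Proof.
move=> lfF; rewrite ltnNge; apply: contra_eqN => /size1_polyC def_F.
move: (line_free_horizontal y lfF).
by rewrite def_F map_polyC hornerC polyC_eq0.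
Qed.

Lemma line_free_factorl G H : line_free (G * H) -> line_free G.
Proof. by move=> lf a b c L def_G; apply: (lf a b c (L * H)); rewrite def_G mulrA. Qed.

Lemma bivar_const G : (size G <= 1)%N -> (sizeY G <= 1)%N -> exists k, G = k%:P%:P.
Proof.
move=> /size1_polyC def_G; have := max_size_coefXY G 0.
by move=> le_sz /(leq_trans le_sz)/size1_polyC def0; exists G`_0`_0; rewrite -def0.
Qed.

Lemma no_root_const (c : {poly K}) : (forall y, c.[y] != 0) -> exists2 k, k != 0 & c = k%:P.
Proof.
move=> c_nz; have [/eqP/size_poly1P[k]|/closed_rootP[y]] := eqVneq (size c) 1%N.
  by move=> k_nz ->; exists k.
by rewrite /root (negPf (c_nz y)).
Qed.

(** A root of b would give F a horizontal line as a factor. *)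
Lemma line_free_primitive F b g : line_free F -> F = b *: g -> exists2 k, k != 0 & b = k%:P.
Proof.
move=> lfF def_F; apply: no_root_const => y; apply: contra (line_free_horizontal y lfF).
by rewrite def_F -mul_polyC rmorphM /= map_polyC /= /horner_eval => /eqP ->; rewrite mul0r.
Qed.

(** A zero resultant gives a common divisor of positive degree in the outer variable, up to
    multipliers from the coefficient ring. Gauss's lemma removes them: by irreducibility F is a
    constant times this divisor, and then, F being primitive, G is a true multiple of F. *)
Lemma resultant0_divides F G : line_free F -> bivar_irreducible F ->
  resultant F G = 0 -> exists Q, G = Q * F.
Proof.
move=> lfF irrF /eqP; rewrite resultant_eq0 => sz_gcd.
have F_nz := line_free_neq0 lfF.
set g := gcdp F G in sz_gcd.
have [[c1 q1] /= c1_nz def_F] := Pdiv.WeakIdomain.dvdpP _ _ (dvdp_gcdl F G).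
have [[c2 q2] /= c2_nz def_G] := Pdiv.WeakIdomain.dvdpP _ _ (dvdp_gcdr F G).
have [a [b [q' [g' [def_F' _ def_g]]]]] := gauss_split c1_nz def_F.
have g'_big : (1 < size g')%N.
  by move: sz_gcd; rewrite /g def_g => /leq_trans->//; apply: size_scale_leq.
have [k def_q'] : exists k, q' = k%:P%:P.
  case: (irrF _ _ def_F') => [[] | []]; first exact: bivar_const.
  by rewrite leqNgt g'_big.
have k_nz : k != 0.
  by apply: contraNneq F_nz => k0; rewrite def_F' def_q' k0 mul0r.
have eqG : (k *: c2) *: G = (b *: q2) * F.
  have -> : k *: c2 = k%:P * c2 by rewrite mul_polyC.
  rewrite -scalerA def_G def_g def_F' def_q' mul_polyC -!scalerAl -!scalerAr.
  by rewrite !scalerA mulrC.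
have kc2_nz : k *: c2 != 0 by rewrite scaler_eq0 negb_or k_nz.
have [a1 [b1 [Q [h [-> _ def_F1]]]]] := gauss_split kc2_nz eqG.
have [k1 k1_nz def_b1] := line_free_primitive lfF def_F1.
exists (k1^-1%:P *: Q); rewrite -scalerAl scalerAr def_F1 def_b1 scalerA -polyCM.
by rewrite mulVf // scale1r.
Qed.

Lemma size_det_le n (M : 'M[{poly K}]_n) D :
  (forall i j, size (M i j) <= D.+1)%N -> (size (\det M) <= (n * D).+1)%N.
Proof.
move=> szM; apply: leq_trans (size_sum _ _ _) _; apply/bigmax_leqP => s _.
rewrite mulr_sign; case: ifP => _; rewrite ?size_polyN.
all: apply: leq_trans (size_prod_leq _ _) _; rewrite card_ord.
all: rewrite leq_subLR addnS ltnS.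
all: apply: (@leq_trans (\sum_(i in 'I_n) D.+1)%N); first by apply: leq_sum => i _.
all: by rewrite sum_nat_const card_ord mulnS.
Qed.

Lemma size_resultant_le F G D : (size F <= D)%N -> (size G <= D)%N ->
    (sizeY F <= D)%N -> (sizeY G <= D)%N ->
  (size (resultant F G) <= (D.*2 * D).+1)%N.
Proof.
move=> szF szG szyF szyG.
apply: leq_trans (size_det_le (D := D) _) _.
  have sz_coef H m (b : bool) : (sizeY H <= D -> size (H`_m *+ b) <= D.+1)%N.
    move=> szH; case: b; rewrite ?mulr1n ?mulr0n ?size_poly0 //.
    by apply: leq_trans (max_size_coefXY _ _) _; apply: leqW.
  by move=> i j; rewrite Sylvester_mxE; case: (split i) => k; apply: sz_coef.
rewrite ltnS leq_mul2r -addnn; apply/orP; right.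
by apply: leq_add; apply: leq_trans (leq_pred _) _.
Qed.

(** A weak form of Bézout: the second coordinate of a common zero is a root of the resultant, and a
    line-free F has at most D zeros on each horizontal line. *)
Lemma common_zeros_card (T : finType) (h : T -> K) F G D : injective h ->
    line_free F -> (size F <= D)%N -> (size G <= D)%N ->
    (sizeY F <= D)%N -> (sizeY G <= D)%N -> (1 < size F)%N -> (1 < size G)%N ->
    resultant F G != 0 ->
  (#|[set P : T * T | (F.[h P.1, h P.2] == 0%R) && (G.[h P.1, h P.2] == 0%R)]|
     <= (D.*2 * D) * D)%N.
Proof.
move=> h_inj lfF szF szG szyF szyG F_gt1 G_gt1 res_nz.
pose B := [set t | (resultant F G).[h t] == 0%R].
apply: (@leq_trans (#|B| * D)%N); last first.
  rewrite leq_mul2r; apply/orP; right; apply: card_roots_le => //.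
  exact: size_resultant_le.
apply: card_le_rows => [[x y]|y _].
  rewrite !inE /= => /andP[/eqP Fxy /eqP Gxy].
  have [[u v] _ /= /(congr1 (fun p => p.[h x, h y]))] := resultant_in_ideal F_gt1 G_gt1.
  by rewrite hornerC !(hornerE, hornerM, hornerD) Fxy Gxy !mulr0 addr0 => ->.
apply: (@leq_trans #|[set x | (map_poly (horner_eval (h y)) F).[h x] == 0%R]|).
  apply/subset_leq_card/subsetP => x; rewrite !inE /= => /andP[Fxy _].
  by rewrite -horner_swapXY horner2_swapXY.
apply: card_roots_le (line_free_horizontal _ lfF) _ => //.
by apply: leq_trans (size_poly _ _) _; apply: leqW.
Qed.

End BivariateDivisibility.

Lemma pred_addn_fixed a b : (a + b).-1 = b -> (0 < b)%N -> a = 1%N.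
Proof. lia. Qed.

Section Translation.
Variable K : numClosedFieldType.
Implicit Types (F G H : {poly {poly K}}) (x y v w : K).

Definition translate v w F : {poly {poly K}} :=
  map_poly (comp_poly ('X + w%:P)) F \Po ('X + v%:P%:P).

Lemma horner_translate v w F x y : (translate v w F).[x, y] = F.[x + v, y + w].
Proof.
rewrite horner_comp hornerD hornerX hornerC -polyCD.
rewrite -[(x + v)%:P in LHS](comp_polyC _ ('X + w%:P)) horner_map /=.
by rewrite horner_comp !hornerE.
Qed.

Lemma comp_polyXaddC_inj (R : comNzRingType) (c : R) : injective (comp_poly ('X + c%:P)).
Proof. by apply: (can_inj (g := comp_poly ('X - c%:P))) => p; apply: comp_polyXaddC_K. Qed.

Lemma size_translate v w F : size (translate v w F) = size F.
Proof.
rewrite size_comp_poly2 ?size_XaddC // size_map_inj_poly ?comp_poly0 //.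
exact: comp_polyXaddC_inj.
Qed.

Lemma lead_coef_translate v w F :
  lead_coef (translate v w F) = lead_coef F \Po ('X + w%:P).
Proof.
rewrite lead_coef_comp ?size_XaddC // lead_coefXaddC expr1n mulr1.
by rewrite lead_coef_map_inj ?comp_poly0 //; apply: comp_polyXaddC_inj.
Qed.

Lemma sizeY_translate v w F D : (sizeY F <= D)%N -> (sizeY (translate v w F) <= D)%N.
Proof.
move=> szF; apply/bigmax_leqP => i _; rewrite coef_comp_poly.
apply: leq_trans (size_sum _ _ _) _; apply/bigmax_leqP => j _.
rewrite coef_map /=.
have -> : 'X + v%:P%:P = map_poly polyC ('X + v%:P).
  by rewrite rmorphD /= map_polyX map_polyC.
rewrite -rmorphXn /= coef_map /= mulrC mul_polyC.
apply: leq_trans (size_scale_leq _ _) _.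
rewrite size_comp_poly2 ?size_XaddC //.
exact: leq_trans (max_size_coefXY _ _) szF.
Qed.

(** Translation keeps the degree in the outer variable, so Q does not involve it. It also keeps the
    degree of the leading coefficient and the leading coefficient of that, so Q is constant and
    equal to 1. *)
Lemma translate_multiple v w F Q : F != 0 -> translate v w F = Q * F -> translate v w F = F.
Proof.
move=> F_nz eqQ.
have Q_nz : Q != 0.
  apply: contraNneq F_nz => Q0; rewrite -size_poly_eq0 -(size_translate v w).
  by rewrite eqQ Q0 mul0r size_poly0.
have szQ : size Q = 1%N.
  move: (size_translate v w F); rewrite eqQ size_mul //.
  by move/pred_addn_fixed; apply; rewrite size_poly_gt0.
have /size1_polyC def_Q : (size Q <= 1)%N by rewrite szQ.
set q := Q`_0 in def_Q.
have q_nz : q != 0 by apply: contraNneq Q_nz => q0; rewrite def_Q q0.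
have lF_nz : lead_coef F != 0 by rewrite lead_coef_eq0.
have /esym := lead_coef_translate v w F; rewrite eqQ def_Q lead_coefM lead_coefC => eq_l.
have szq : size q = 1%N.
  have /esym := congr1 (fun p : {poly K} => size p) eq_l.
  rewrite size_comp_poly2 ?size_XaddC // size_mul //.
  by move/pred_addn_fixed; apply; rewrite size_poly_gt0.
have /size1_polyC def_q : (size q <= 1)%N by rewrite szq.
have := congr1 (fun p : {poly K} => lead_coef p) eq_l.
rewrite lead_coef_comp ?size_XaddC // lead_coefXaddC expr1n mulr1.
rewrite lead_coefM def_q lead_coefC => /eqP.
rewrite -{1}[lead_coef (lead_coef F)]mul1r => /eqP/mulIf <-; first by rewrite mul1r.
by rewrite lead_coef_eq0.
Qed.

(** By invariance one zero spreads along the direction (v, w). If this vector is nonzero, F has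
    infinitely many zeros on one line and vanishes on it, contrary to line-freeness. *)
Lemma translate_invariant_line v w F x y : line_free F ->
  translate v w F = F -> F.[x, y] = 0 -> v = 0 /\ w = 0.
Proof.
move=> lfF invF Fxy.
have F0 n : F.[x + n%:R * v, y + n%:R * w] = 0.
  elim: n => [|n IHn]; first by rewrite !mul0r !addr0.
  by rewrite -addn1 natrD !mulrDl !mul1r !addrA -horner_translate invF.
have [w0|w_nz] := eqVneq w 0.
  split=> //; apply/eqP/contraT => v_nz.
  have /eqP : map_poly (horner_eval y) F = 0.
    apply: (poly_eq0_progression v_nz) => n.
    by move: (F0 n); rewrite w0 mulr0 addr0 -horner_swapXY horner2_swapXY; apply.
  by rewrite (negPf (line_free_horizontal _ lfF)).
have /eqP : F.[(v / w) *: 'X + (x - v / w * y)%:P] = 0.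
  apply: (poly_eq0_progression w_nz (a := y)) => n; set z := y + _.
  rewrite -/(horner_eval z _) -horner_map /= /horner_eval hornerD hornerZ hornerX hornerC.
  have -> : v / w * z + (x - v / w * y) = x + n%:R * v by rewrite /z; field.
  by rewrite -[map_poly _ F]horner_swapXY horner2_swapXY F0.
by rewrite (negPf (line_free_graph _ _ lfF)).
Qed.

Lemma translate_common_zeros_card (T : finType) (h : T -> K) F D v w :
    injective h -> line_free F -> bivar_irreducible F ->
    (size F <= D)%N -> (sizeY F <= D)%N -> (v != 0) || (w != 0) ->
  (#|[set P : T * T | (F.[h P.1, h P.2] == 0%R)
       && (F.[h P.1 + v, h P.2 + w] == 0%R)]| <= (D.*2 * D) * D)%N.
Proof.
move=> h_inj lfF irrF szF szyF vw_nz; set A := [set _ | _].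
(* A point of the set is needed: it shows that F involves the outer variable, and it starts the
   progression of zeros. *)
have [->|[P PA]] := set_0Vmem A; first by rewrite cards0.
have FP : F.[h P.1, h P.2] = 0 by move: PA; rewrite inE => /andP[/eqP].
have F_gt1 := line_free_size lfF FP.
have res_nz : resultant F (translate v w F) != 0.
  apply/eqP => /(resultant0_divides lfF irrF)[Q].
  move/(translate_multiple (line_free_neq0 lfF)) => invF.
  have [v0 w0] := translate_invariant_line lfF invF FP.
  by rewrite v0 w0 eqxx in vw_nz.
have := common_zeros_card h_inj lfF szF _ szyF _ F_gt1 _ res_nz.
rewrite size_translate => /(_ szF (sizeY_translate v w szyF) F_gt1).
by under eq_finset do rewrite horner_translate.
Qed.

End Translation.

(** * Reduction modulo a prime *)

(* A maximal minor that is nonzero in [E] is a nonzero integer, hence nonzero in [K]. *)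
Lemma int_mx_kernel_transfer (K : numFieldType) (E : fieldType) m n
    (M : 'M[int]_(m, n)) (u : 'cV[K]_n) :
    u != 0 -> map_mx intr M *m u = 0 ->
  exists2 v : 'cV[E]_n, v != 0 & map_mx intr M *m v = 0.
Proof.
move=> u_nz Mu0; set ME : 'M[E]_(m, n) := map_mx intr M.
have [full|not_full] := boolP (row_full ME).
  have := fullrowsub_unit full; rewrite -map_mxsub unitmxE det_map_mx unitfE => det_nz.
  have detM_nz : \det (mxsub (fullrankfun full) id M) != 0.
    by apply: contraNneq det_nz => ->; rewrite rmorph0.
  have unitK : rowsub (fullrankfun full) (map_mx intr M : 'M[K]_(m, n)) \in unitmx.
    by rewrite -map_mxsub unitmxE det_map_mx unitfE intr_eq0.
  case/eqP: u_nz; rewrite -[u](mulKmx unitK) mul_rowsub_mx Mu0.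
  by rewrite (_ : rowsub _ 0 = 0) ?mulmx0 //; apply/matrixP => i j; rewrite !mxE.
have ker_nz : kermx ME^T != 0.
  rewrite -mxrank_eq0 mxrank_ker mxrank_tr subn_eq0 -ltnNge ltn_neqAle rank_leq_col andbT.
  exact: not_full.
have /rowV0Pn[v /sub_kermxP vM v_nz] := ker_nz.
exists v^T; first by rewrite trmx_eq0.
by rewrite -[LHS]trmxK trmx_mul trmxK vM trmx0.
Qed.

Definition powers (R : nzRingType) D (x : R) : 'rV_D := \row_(a < D) x ^+ a.

Definition coef_mx (R : nzRingType) D (F : {poly {poly R}}) : 'M[R]_D :=
  \matrix_(a, b) F`_a`_b.

Definition poly_of_mx (R : nzRingType) D (A : 'M[R]_D) : {poly {poly R}} :=
  rVpoly (\row_a rVpoly (row a A)).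

Lemma poly_of_mxK (R : nzRingType) D : cancel (@poly_of_mx R D) (@coef_mx R D).
Proof.
by move=> A; apply/matrixP=> i j; rewrite !mxE coef_rVpoly_ord mxE coef_rVpoly_ord mxE.
Qed.

Lemma size_poly_of_mx (R : nzRingType) D (A : 'M[R]_D) : (size (poly_of_mx A) <= D)%N.
Proof. exact: size_poly. Qed.

Lemma sizeY_poly_of_mx (R : nzRingType) D (A : 'M[R]_D) : (sizeY (poly_of_mx A) <= D)%N.
Proof.
apply/bigmax_leqP => a _; rewrite coef_rVpoly; case: insub => [i|]; last by rewrite size_poly0.
by rewrite mxE size_poly.
Qed.

Lemma horner_coef_mx (R : comNzRingType) D (F : {poly {poly R}}) x y :
    (size F <= D)%N -> (sizeY F <= D)%N ->
  powers D x *m coef_mx D F *m (powers D y)^T = F.[x, y]%:M.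
Proof.
move=> szF szyF; apply/matrixP => i j; rewrite !ord1 !mxE mulr1n.
rewrite (horner_coef_wide _ szF) horner_sum; under eq_bigr do rewrite !mxE mulr_suml.
rewrite exchange_big /=; apply: eq_bigr => a _.
rewrite -polyC_exp hornerM hornerC mulrC.
rewrite (@horner_coef_wide _ D) ?(leq_trans (max_size_coefXY _ _)) // mulr_sumr.
by apply: eq_bigr => b _; rewrite !mxE mulrA.
Qed.

Lemma coef_mx_eq0 (R : nzRingType) D (F : {poly {poly R}}) :
  (size F <= D)%N -> (sizeY F <= D)%N -> coef_mx D F = 0 -> F = 0.
Proof.
move=> szF szyF A0; apply/polyP => a; apply/polyP => b; rewrite !coef0.
have [leDa|ltaD] := leqP D a; first by rewrite [F`_a]nth_default ?coef0 ?(leq_trans szF).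
have [leDb|ltbD] := leqP D b.
  by rewrite nth_default // (leq_trans (max_size_coefXY _ _)) // (leq_trans szyF).
by have /matrixP/(_ (Ordinal ltaD) (Ordinal ltbD)) := A0; rewrite !mxE.
Qed.

(** Vanishing at the given points is a linear system in the D^2 coefficients whose matrix of
    monomial values is integral, so a nonzero solution over K yields one over E. *)
Lemma vanishing_transfer (K : numFieldType) (E : fieldType) (T : finType)
    (h1 h2 : T -> nat) D (F : {poly {poly K}}) :
    F != 0 -> (size F <= D)%N -> (sizeY F <= D)%N ->
    (forall t, F.[(h1 t)%:R, (h2 t)%:R] = 0) ->
  exists G : {poly {poly E}}, [/\ G != 0, (size G <= D)%N, (sizeY G <= D)%N &
    forall t, G.[(h1 t)%:R, (h2 t)%:R] = 0].
Proof.
move=> F_nz szF szyF F0.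
pose r (R : nzRingType) t : 'rV[R]_(D * D) :=
  mxvec ((powers D (h1 t)%:R)^T *m powers D (h2 t)%:R).
pose M : 'M[int]_(#|T|, D * D) := \matrix_i r int (enum_val i).
have rowM (R : comNzRingType) i : row i (map_mx intr M : 'M[R]_(_, _)) = r R (enum_val i).
  rewrite -map_row rowK /r map_mxvec map_mxM -map_trmx; congr (mxvec (_^T *m _)).
    by apply/rowP => a; rewrite !mxE rmorphXn /= rmorph_nat.
  by apply/rowP => a; rewrite !mxE rmorphXn /= rmorph_nat.
have rowMv (R : comNzRingType) (A : 'M[R]_D) i :
    row i (map_mx intr M *m (mxvec A)^T) =
      powers D (h1 (enum_val i))%:R *m A *m (powers D (h2 (enum_val i))%:R)^T.
  by rewrite row_mul rowM mxvec_dotmul.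
have [] := @int_mx_kernel_transfer K E _ _ M (mxvec (coef_mx D F))^T.
- rewrite trmx_eq0 mxvec_eq0; apply: contraNneq F_nz => A0.
  by apply/eqP/(coef_mx_eq0 szF szyF).
- by apply/row_matrixP => i; rewrite rowMv horner_coef_mx // F0 row0 raddf0.
move=> v v_nz Mv0; pose A : 'M[E]_D := vec_mx v^T.
have def_v : v = (mxvec A)^T by rewrite vec_mxK trmxK.
exists (poly_of_mx A); split; rewrite ?size_poly_of_mx ?sizeY_poly_of_mx //.
  apply: contraNneq v_nz => G0; rewrite def_v -[A]poly_of_mxK G0.
  rewrite (_ : coef_mx D 0 = 0) ?linear0 ?trmx0 //.
  by apply/matrixP => a b; rewrite !mxE !coef0.
move=> t; have := congr1 (row (enum_rank t)) Mv0.
rewrite {1}def_v rowMv enum_rankK row0.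
rewrite -{1}[A]poly_of_mxK horner_coef_mx ?size_poly_of_mx ?sizeY_poly_of_mx //.
by move/matrixP/(_ 0 0); rewrite !mxE eqxx mulr1n.
Qed.

(** G may contain horizontal lines, but only at roots of its leading coefficient: at most D rows,
    each with at most #|E| points. Every other row has at most D zeros. *)
Lemma finField_zeros_card (E : finFieldType) (G : {poly {poly E}}) D :
    G != 0 -> (size G <= D)%N -> (sizeY G <= D)%N ->
  (#|[set P : E * E | G.[P.1, P.2] == 0%R]| <= D.*2 * #|E|)%N.
Proof.
move=> G_nz szG szyG; pose B := [set y | (lead_coef G).[y] == 0%R].
set A := [set _ | _].
have cardB : (#|B| <= D)%N.
  apply: (card_roots_le (h := id)); rewrite ?lead_coef_eq0 //.
  by apply: leqW; apply: leq_trans (max_size_lead_coefXY _) szyG.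
rewrite -(cardsID [set P | P.2 \in B] A) -addnn mulnDl; apply: leq_add.
  apply: (@leq_trans (#|B| * #|E|)%N); last by rewrite leq_mul2r cardB orbT.
  by apply: card_le_rows => [P|y _]; [rewrite !inE => /andP[]|apply: max_card].
apply: (@leq_trans (#|~: B| * D)%N); last by rewrite mulnC leq_mul2l max_card orbT.
apply: card_le_rows => [P|y]; first by rewrite !inE => /andP[].
rewrite !inE => ly_nz; have Gy_nz : map_poly (horner_eval y) G != 0.
  apply: contraNneq ly_nz => /(congr1 (fun p : {poly E} => p`_(size G).-1)).
  by rewrite coef_map coef0 /= => /eqP.
apply: (@leq_trans #|[set x | (map_poly (horner_eval y) G).[x] == 0%R]|).
  apply/subset_leq_card/subsetP => x; rewrite !inE /= => /andP[_].
  by rewrite -horner_swapXY horner2_swapXY.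
apply: (card_roots_le (h := id)) => //.
by apply: leq_trans (size_poly _ _) _; apply: leqW.
Qed.

(** Cauchy-Schwarz for the fibre sizes, obtained by summing 2 xy <= x^2 + y^2 over all pairs of
    fibres. The diagonal pairs are counted too. *)
Lemma collision_card (T U : finType) (f : T -> U) (S : {set T}) :
  (#|S| ^ 2 <= #|f @: S| *
     #|[set PQ : T * T | [&& PQ.1 \in S, PQ.2 \in S & f PQ.1 == f PQ.2]]|)%N.
Proof.
set W := [set _ | _]; pose a u := #|[set t in S | f t == u]|.
have cardS : #|S| = (\sum_(u in f @: S) a u)%N.
  rewrite -sum1_card (partition_big f (mem (f @: S))) /=; last first.
    by move=> t tS; apply: imset_f.
  by apply: eq_bigr => u _; rewrite /a -sum1_card; apply: eq_bigl => t; rewrite inE.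
have cardW : #|W| = (\sum_(u in f @: S) a u * a u)%N.
  rewrite -sum1_card (partition_big (fun PQ => f PQ.1) (mem (f @: S))) /=; last first.
    by move=> PQ; rewrite inE => /and3P[PS _ _]; apply: imset_f.
  apply: eq_bigr => u _; rewrite sum1_card -cardsX; apply: eq_card => -[t t'].
  rewrite unfold_in /= !inE /=; case: (f t =P u) => [<-|_]; last by rewrite !andbF.
  by rewrite !andbT [f t' == _]eq_sym.
have cs : (2 * (#|S| * #|S|) <= 2 * (#|f @: S| * #|W|))%N.
  rewrite {1 2}cardS big_distrl big_distrr /=.
  apply: (@leq_trans (\sum_(u in f @: S) \sum_(v in f @: S) (a u * a u + a v * a v))%N).
    apply: leq_sum => u _; rewrite !big_distrr /=; apply: leq_sum => v _.
    by rewrite !mulnn (nat_Cauchy (a u) (a v)).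
  under eq_bigr do rewrite big_split sum_nat_const /= -cardW.
  by rewrite big_split /= -big_distrr /= -cardW sum_nat_const mul2n -addnn.
by rewrite -mulnn; move: cs; rewrite leq_pmul2l.
Qed.

Definition lattice_zeros (R : nzRingType) k (F : {poly {poly R}}) : {set 'I_k * 'I_k} :=
  [set P : 'I_k * 'I_k | F.[P.1%:R, P.2%:R] == 0%R].

Definition class_mod (p : nat) k (P : 'I_k * 'I_k) : 'F_p * 'F_p := (P.1%:R, P.2%:R).
Arguments class_mod p {k} P.

(* The offset [(b - a) / p] of two congruent numbers below [k], shifted by
   [k %/ p] to be a natural number. *)
Definition offset (p k a b : nat) : nat := (b %/ p + k %/ p - a %/ p)%N.

Lemma offsetP p k a b : prime p -> (a < k)%N -> (b < k)%N -> a%:R = b%:R :> 'F_p ->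
  (b + p * (k %/ p) = a + p * offset p k a b)%N /\ (offset p k a b <= 2 * (k %/ p))%N.
Proof.
move=> prp ltak ltbk /(congr1 val); rewrite /= !val_Fp_nat // => eq_ab.
(* This makes the truncated subtraction in [offset] exact; together with [lb] it bounds the
   offset. *)
have la : (a %/ p <= k %/ p)%N by apply/leq_div2r/ltnW.
have lb : (b %/ p <= k %/ p)%N by apply/leq_div2r/ltnW.
rewrite /offset {1}(divn_eq b p) {1}(divn_eq a p) eq_ab.
have lpa : (p * (a %/ p) <= p * (k %/ p))%N by rewrite leq_mul2l la orbT.
move: lpa la lb; move: (a %/ p)%N (b %/ p)%N (k %/ p)%N => x y q.
by split; [rewrite mulnBr mulnDr; nia|lia].
Qed.

(** * Counting lattice points on a line-free curve *)

Section Counting.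
Variable K : numClosedFieldType.
Implicit Types F G H : {poly {poly K}}.

(** The first term counts the diagonal. Other pairs are sorted by their two offsets; for a fixed
    nonzero displacement the first point lies on F and on a proper translate of F. *)
Lemma congruent_pairs_card F D k p : prime p -> line_free F -> bivar_irreducible F ->
    (size F <= D)%N -> (sizeY F <= D)%N ->
  (#|[set PQ : ('I_k * 'I_k) * ('I_k * 'I_k) |
       [&& PQ.1 \in lattice_zeros k F, PQ.2 \in lattice_zeros k F
         & class_mod p PQ.1 == class_mod p PQ.2]]|
    <= #|lattice_zeros k F| + (2 * (k %/ p)).+1 ^ 2 * (D.*2 * D * D))%N.
Proof.
move=> prp lfF irrF szF szyF; set S := lattice_zeros k F; set W := [set _ | _].
set q := (k %/ p)%N; rewrite -(cardsID [set PQ | PQ.1 == PQ.2] W); apply: leq_add.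
  rewrite -[leqRHS]muln1; apply: (card_le_fibers (g := fst)) => [PQ|P _].
    by rewrite !inE -andbA => /andP[].
  rewrite -(cards1 (P, P)); apply/subset_leq_card/subsetP => -[P1 P2].
  by rewrite !inE /= => /andP[/andP[_ /eqP <-] /eqP ->].
pose g (PQ : ('I_k * 'I_k) * ('I_k * 'I_k)) : 'I_(2 * q).+1 * 'I_(2 * q).+1 :=
  (inord (offset p k PQ.1.1 PQ.2.1), inord (offset p k PQ.1.2 PQ.2.2)).
rewrite -mulnn -[X in (X * X)%N]card_ord -card_prod -cardsT.
apply: (card_le_fibers (g := g)) => // u _; set A := [set _ in _ | _].
(* The displacement encoded by the offset i, with the shift by q undone. *)
pose v i : K := p%:R * (i%:R - q%:R).
have Av PQ : PQ \in A -> [/\ PQ.1 \in S, PQ.2 \in S, PQ.1 != PQ.2,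
    PQ.2.1%:R = PQ.1.1%:R + v u.1 & PQ.2.2%:R = PQ.1.2%:R + v u.2].
  rewrite !inE => /andP[/and4P[PQ_neq S1 S2 /eqP[eq1 eq2]] /eqP <-].
  have [off1 le1] := offsetP prp (ltn_ord _) (ltn_ord _) eq1.
  have [off2 le2] := offsetP prp (ltn_ord _) (ltn_ord _) eq2.
  have natv a b e : (b + p * q = a + p * e)%N -> b%:R = a%:R + v e.
    move/(congr1 (fun n => n%:R : K)); rewrite !natrD !natrM /v => eq_ba.
    by rewrite mulrBr addrA -eq_ba addrK.
  by split=> //; apply: natv; rewrite /g inordK.
have [->|[PQ0 /Av[_ _ neq0 eq01 eq02]]] := set_0Vmem A; first by rewrite cards0.
have vw_nz : (v u.1 != 0) || (v u.2 != 0).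
  rewrite -negb_and; apply: contra neq0 => /andP[/eqP v0 /eqP w0].
  move: eq01 eq02; rewrite v0 w0 !addr0 => /eqP eq1 /eqP eq2.
  rewrite -pair_eqE /= -!val_eqE /= eq_sym; move: eq1 eq2.
  by rewrite !eqr_nat => /eqP-> /eqP->; rewrite !eqxx.
have h_inj : injective (fun i : 'I_k => i%:R : K).
  by move=> i j /eqP; rewrite eqr_nat => /eqP/val_inj.
apply: leq_trans (translate_common_zeros_card h_inj lfF irrF szF szyF vw_nz).
(* With the displacement fixed, a pair is determined by its first point. *)
rewrite -(card_in_imset (f := fst)) => [|PQ PQ' /Av[_ _ _ e1 e2] /Av[_ _ _ e1' e2'] eqP1].
  apply/subset_leq_card/subsetP => P /imsetP[PQ /Av[S1 S2 _ eq1 eq2] ->].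
  by move: S1 S2; rewrite !inE eq1 eq2 => -> ->.
case: PQ PQ' => [P [Q1 Q2]] [P' [Q1' Q2']] /= in eqP1 e1 e2 e1' e2' *.
by rewrite -eqP1 -?e1 -?e2 in e1' e2' *; congr (_, (_, _)); apply: h_inj.
Qed.

(** The residues of all lattice zeros lie on one nonzero curve over ['F_p] with the same size
    bounds. *)
Lemma residue_classes_card F D k p : prime p -> F != 0 ->
    (size F <= D)%N -> (sizeY F <= D)%N ->
  (#|class_mod p @: lattice_zeros k F| <= D.*2 * p)%N.
Proof.
move=> prp F_nz szF szyF; pose T := {P : 'I_k * 'I_k | P \in lattice_zeros k F}.
have [|G [G_nz szG szyG G0]] := @vanishing_transfer K 'F_p T
    (fun P => val (val P).1) (fun P => val (val P).2) D F F_nz szF szyF.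
  by case=> P /=; rewrite inE => /eqP.
rewrite -[X in (_ * X)%N](card_Fp prp).
apply: leq_trans (finField_zeros_card G_nz szG szyG).
apply/subset_leq_card/subsetP => _ /imsetP[P PS ->].
by rewrite inE /=; apply/eqP; apply: (G0 (exist _ P PS)).
Qed.

(** On the right of the collision inequality, 2DpN is at most N^2 / 2, and (2q + 1)^2 <= 9q^2 + 1
    leaves 18Dpq^2B plus 2DpB <= N^2 / 4. Hence N^2 <= 72Dpq^2B; multiplying by N < 256Dp and using
    qp <= k gives the bound. *)
Lemma card_cube_bound N D p q k B : (0 < D)%N ->
    (N ^ 2 <= D.*2 * p * (N + (2 * q).+1 ^ 2 * B))%N ->
    (4 * D * p <= N)%N -> (N < 256 * D * p)%N -> (2 * B <= N)%N -> (q * p <= k)%N ->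
  (N ^ 3 <= 256 * 72 * D ^ 2 * B * k ^ 2)%N.
Proof.
move=> D_gt0 collisions lepN ltNp leBN leqk.
have le_q2 : ((2 * q).+1 ^ 2 <= 9 * q ^ 2 + 1)%N.
  by case: q {collisions leqk} => [|q]; rewrite // -!mulnn; nia.
have sq_bound : (N ^ 2 <= 72 * (D * p * q ^ 2 * B))%N.
  have c1 : (2 * (D.*2 * p * N) <= N ^ 2)%N by rewrite -mulnn; nia.
  have c2 : (4 * (D.*2 * p * B) <= N ^ 2)%N by rewrite -mulnn; nia.
  have c3 : (D.*2 * p * ((2 * q).+1 ^ 2 * B) <= 18 * (D * p * q ^ 2 * B) + D.*2 * p * B)%N.
    apply: (@leq_trans (D.*2 * p * ((9 * q ^ 2 + 1) * B))%N); last by nia.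
    by rewrite leq_mul2l leq_mul2r le_q2 !orbT.
  by rewrite mulnDr in collisions; lia.
have sq_pq : (q ^ 2 * p ^ 2 <= k ^ 2)%N by rewrite -expnMn leq_exp2r.
apply: (@leq_trans (256 * D * p * (72 * (D * p * q ^ 2 * B)))%N).
  by rewrite expnS; apply: leq_mul => //; apply: ltnW.
apply: (@leq_trans (256 * 72 * D ^ 2 * B * (q ^ 2 * p ^ 2))%N); first by rewrite -!mulnn; lia.
by rewrite leq_mul2l sq_pq orbT.
Qed.

Lemma irreducible_lattice_zeros_card D : exists C, forall F,
    line_free F -> bivar_irreducible F -> (size F <= D)%N -> (sizeY F <= D)%N ->
  forall k, (0 < k)%N -> (#|lattice_zeros k F| ^ 3 <= C * k ^ 2)%N.
Proof.
(* [B] bounds the points shared with a proper translate. From [N0] on, N / (4D) is at least 4^5, as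
   the choice of a prime requires, and N >= 2B. *)
pose B := (D.*2 * D * D)%N; pose N0 := (4 * D * 4 ^ 5 + 2 * B)%N.
exists (N0 ^ 3 + 256 * 72 * D ^ 2 * B)%N => F lfF irrF szF szyF k k_gt0.
set N := #|_|; rewrite mulnDl.
have [ltN|leN] := ltnP N N0.
  apply: leq_trans (leq_addr _ _); apply: leq_trans (_ : N0 ^ 3 <= _)%N.
    by rewrite leq_exp2r // ltnW.
  by rewrite leq_pmulr // expn_gt0 k_gt0.
have D_gt0 : (0 < D)%N.
  by apply: leq_trans szF; rewrite size_poly_gt0 line_free_neq0.
(* Here 4^s <= N / (4D) < 4^(s+1), so a prime p in (4^(s-2), 4^s] satisfies 4Dp <= N < 4D * 64 *
   4^(s-2) < 256Dp. *)
pose s := trunc_log 4 (N %/ (4 * D)).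
have ND_gt : (4 ^ 5 <= N %/ (4 * D))%N.
  by rewrite leq_divRL ?muln_gt0 // mulnC (leq_trans _ leN) // /N0 leq_addr.
have s_ge5 : (5 <= s)%N by apply: trunc_log_max.
have [p prp /andP[ltp lep]] := exists_prime_pow4 s_ge5.
apply: leq_trans (leq_addl _ _); apply: (@card_cube_bound _ _ p (k %/ p)) => //.
- apply: leq_trans (collision_card (class_mod p) _) _.
  apply: leq_mul; first by apply: residue_classes_card => //; apply: line_free_neq0.
  exact: congruent_pairs_card.
- have : (p <= N %/ (4 * D))%N.
    by apply: leq_trans lep _; apply: trunc_logP => //; apply: leq_trans ND_gt.
  by rewrite leq_divRL ?muln_gt0 // mulnC.
- have : (N %/ (4 * D) < 4 ^ s.+1)%N by apply: trunc_log_ltn.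
  rewrite ltn_divLR ?muln_gt0 // => ltN; apply: leq_trans ltN _.
  have -> : s.+1 = (s - 2 + 3)%N by lia.
  by rewrite expnD; nia.
- by apply: leq_trans leN; rewrite /N0 leq_addl.
exact: leq_trunc_div.
Qed.

Lemma lattice_zerosM k F G :
  lattice_zeros k (F * G) = lattice_zeros k F :|: lattice_zeros k G.
Proof. by apply/setP => P; rewrite !inE !hornerM mulf_eq0. Qed.

(** Degrees add in each variable, and a nonconstant factor has positive degree in at least one of
    them, so the cofactor is strictly smaller. *)
Lemma bivar_factor F : F != 0 -> ~ bivar_irreducible F -> exists G H,
  [/\ F = G * H, (size G + sizeY G < size F + sizeY F)%N
    & (size H + sizeY H < size F + sizeY F)%N].
Proof.
move=> F_nz red; apply: NNPP => no_fact; apply: red => G H def_F.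
apply: NNPP => /not_or_and[nG nH]; apply: no_fact; exists G, H.
have [G_nz H_nz] : G != 0 /\ H != 0 by apply/andP; rewrite -negb_or -mulf_eq0 -def_F.
have szF : size F = (size G + size H).-1 by rewrite def_F size_mul.
have szyF : sizeY F = (sizeY G + sizeY H).-1.
  by rewrite !sizeYE def_F rmorphM size_mul ?swapXY_eq0.
have szG : (0 < size G)%N by rewrite size_poly_gt0.
have szH : (0 < size H)%N by rewrite size_poly_gt0.
have szyG : (0 < sizeY G)%N by rewrite lt0n sizeY_eq0.
have szyH : (0 < sizeY H)%N by rewrite lt0n sizeY_eq0.
rewrite {}szF {}szyF; move: nG nH szG szH szyG szyH.
move: (size G) (size H) (sizeY G) (sizeY H) => a c b e; split=> //; lia.
Qed.

(** Induction on the sum of the two sizes: a reducible curve is the union of two smaller line-free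
    curves, so the constant depends only on the size bound. *)
Theorem lattice_zeros_card n : exists C, forall F,
    line_free F -> (size F + sizeY F <= n)%N ->
  forall k, (0 < k)%N -> (#|lattice_zeros k F| ^ 3 <= C * k ^ 2)%N.
Proof.
elim: n => [|n [C IHn]].
  exists 0%N => F /line_free_neq0; rewrite -size_poly_gt0 leqn0 addn_eq0.
  by move=> F_gt0 /andP[/eqP F0]; rewrite F0 in F_gt0.
have [C0 irrC] := irreducible_lattice_zeros_card n.+1.
exists (C0 + 8 * C)%N => F lfF szn k k_gt0.
have [irrF|redF] := classic (bivar_irreducible F).
  apply: leq_trans (irrC F lfF irrF _ _ k k_gt0) _; last by rewrite leq_mul2r leq_addr orbT.
    exact: leq_trans (leq_addr _ _) szn.
  exact: leq_trans (leq_addl _ _) szn.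
have F_nz := line_free_neq0 lfF.
have [G [H [def_F szG szH]]] := bivar_factor F_nz redF.
have lfG : line_free G by apply: (line_free_factorl (H := H)); rewrite -def_F.
have lfH : line_free H by apply: (line_free_factorl (H := G)); rewrite mulrC -def_F.
have := IHn G lfG (leq_trans szG szn) k k_gt0.
have := IHn H lfH (leq_trans szH szn) k k_gt0.
have : (#|lattice_zeros k F| <= #|lattice_zeros k G| + #|lattice_zeros k H|)%N.
  by rewrite def_F lattice_zerosM cardsU leq_subr.
move: #|_| #|_| #|_| => c b a le_a le_b le_c; rewrite mulnDl.
(* Convexity of the cube, (b + c)^3 <= 4 (b^3 + c^3), is the source of the factor 8 in front of
   [C]. *)
apply: (@leq_trans (4 * (b ^ 3 + c ^ 3))%N); last first.
  by move: (b ^ 3)%N (c ^ 3)%N (k ^ 2)%N le_b le_c => x y z; lia.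
apply: (@leq_trans ((b + c) ^ 3)%N); first by rewrite leq_exp2r.
rewrite !expnS !expn0; have [/subnK <-|/ltnW/subnK <-] := leqP b c; nia.
Qed.

End Counting.

(** * From curves on grids to lattice points *)

(* [mpoly] is imported inside a module because its notations clash with those
   of the analysis library. *)
Module AffinePullback.

From mathcomp Require Import mpoly.

Section Pullback.
Variable K : closedFieldType.
Variables a b c e : K.
Implicit Type f : {mpoly K[2]}.

Definition affine_coord (i : 'I_2) : {poly {poly K}} :=
  if i == ord0 then b%:P%:P * 'X + a%:P%:P else (e *: 'X + c%:P)%:P.

Definition pullback f : {poly {poly K}} := mmap (polyC \o polyC) affine_coord f.

Lemma pullbackE f : pullback f =
  \sum_(m <- msupp f) (f@_m)%:P%:P *
    (affine_coord ord0 ^+ m ord0 * affine_coord (inord 1) ^+ m (inord 1)).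
Proof.
rewrite /pullback /mmap; apply: eq_bigr => m _; rewrite /mmap1 !big_ord_recl big_ord0 mulr1.
by rewrite (_ : lift _ _ = inord 1) //; apply: val_inj; rewrite /= inordK.
Qed.

Lemma horner_pullback f x y : (pullback f).[x, y] = eval2 f (a + b * x, c + e * y).
Proof.
rewrite pullbackE !horner_sum /eval2 /meval /mmap; apply: eq_bigr => m _.
rewrite /mmap1 !big_ord_recl big_ord0 mulr1 (_ : lift _ _ = inord 1); last first.
  by apply: val_inj; rewrite /= inordK.
rewrite /affine_coord eqxx -val_eqE /= inordK //=.
rewrite !(hornerM, hornerC, horner_exp, hornerD, hornerX, hornerZ).
rewrite !(tnth_nth 0) /= inordK //=.
by rewrite [a + _]addrC [c + _]addrC.
Qed.

Lemma size_monomial_le (k : K) (g h : {poly {poly K}}) i j :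
    (size g <= 2)%N -> (size h <= 2)%N ->
  (size (k%:P%:P * (g ^+ i * h ^+ j))%R <= (i + j).+1)%N.
Proof.
move=> szg szh; rewrite mul_polyC; apply: leq_trans (size_scale_leq _ _) _.
apply: leq_trans (size_polyMleq _ _) _.
have expl (p : {poly {poly K}}) n : (size p <= 2)%N -> (size (p ^+ n) <= n.+1)%N.
  by move=> szp; apply: leq_trans (size_poly_exp_leq _ _) _; rewrite ltnS; nia.
move: (expl _ i szg) (expl _ j szh); move: (size (g ^+ i)) (size (h ^+ j)) => s t; lia.
Qed.

Lemma mdeg2 (m : 'X_{1..2}) : mdeg m = (m ord0 + m (inord 1))%N.
Proof.
rewrite mdegE !big_ord_recl big_ord0 addn0; congr (_ + m _)%N.
by apply: val_inj; rewrite /= inordK.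
Qed.

Lemma size_affine_le (S : nzRingType) (r t : S) : (size (r *: 'X + t%:P)%R <= 2)%N.
Proof.
rewrite (leq_trans (size_polyD _ _)) // geq_max (leq_trans (size_scale_leq _ _)) ?size_polyX //.
by rewrite (leq_trans (size_polyC_leq1 _)).
Qed.

Lemma size_pullback f : (size (pullback f) <= msize f)%N.
Proof.
rewrite pullbackE big_seq;
apply: leq_trans (size_sum _ _ _) _; apply/bigmax_leqP_seq => m mf _.
apply: leq_trans (msize_mdeg_lt mf); rewrite mdeg2; apply: size_monomial_le.
  rewrite /affine_coord eqxx mul_polyC.
  by rewrite size_affine_le.
by rewrite /affine_coord -val_eqE /= inordK // (leq_trans (size_polyC_leq1 _)).
Qed.

Lemma sizeY_pullback f : (sizeY (pullback f) <= msize f)%N.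
Proof.
rewrite sizeYE pullbackE rmorph_sum big_seq.
apply: leq_trans (size_sum _ _ _) _; apply/bigmax_leqP_seq => m mf _.
apply: leq_trans (msize_mdeg_lt mf); rewrite mdeg2 !rmorphM !rmorphXn /=.
rewrite swapXY_polyC map_polyC /=.
apply: size_monomial_le.
  rewrite /affine_coord eqxx rmorphD rmorphM /= !swapXY_polyC !map_polyC /= swapXY_X.
  by rewrite -polyCM -polyCD (leq_trans (size_polyC_leq1 _)).
rewrite /affine_coord -val_eqE /= inordK //= swapXY_polyC rmorphD /=.
rewrite map_polyZ map_polyX map_polyC /=.
by rewrite size_affine_le.
Qed.

Hypotheses (b_nz : b != 0) (e_nz : e != 0).

(** The lower bound comes from a nonzero coefficient at a monomial of degree one. *)
Lemma msize_linear (r s t : K) : (r != 0) || (s != 0) ->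
  msize (r *: 'X_(ord0 : 'I_2) + s *: 'X_(inord 1) + t%:MP) = 2.
Proof.
move=> rs_nz; set L := _ + _; apply/eqP; rewrite eqn_leq; apply/andP; split.
  rewrite (leq_trans (msizeD_le _ _)) // geq_max (leq_trans (msizeD_le _ _)) ?geq_max.
    by rewrite msizeC; case: eqP.
  by rewrite !(leq_trans (msizeZ_le _ _)) // msizeX mdeg1.
have coefL i : L@_U_(i) = r * (ord0 == i)%:R + s * (inord 1 == i)%:R.
  by rewrite !mcoeffD !mcoeffZ !mcoeffX mcoeffC mnm1_eq0 mulr0 addr0 !eq_mnm1.
have [i Li] : exists i, L@_U_(i) != 0.
  have [r0|r_nz] := eqVneq r 0; last exists ord0.
    exists (inord 1); rewrite coefL r0 mul0r add0r eqxx mulr1.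
    by rewrite r0 eqxx in rs_nz.
  by rewrite coefL eqxx mulr1 -val_eqE /= inordK // mulr0 addr0.
by have := msize_mdeg_lt (_ : U_(i)%MM \in msupp L); rewrite mdeg1 mcoeff_msupp; apply.
Qed.

(** Substitution of (x - a) / b and (y - c) / e for the two variables. Being a ring morphism, it
    carries factorizations of the pullback back to f. *)
Definition affine_inverse : {poly {poly K}} -> {mpoly K[2]} :=
  horner_eval (b^-1 *: ('X_ord0 - a%:MP)) \o
  map_poly (horner_eval (e^-1 *: ('X_(inord 1) - c%:MP)) \o map_poly (@mpolyC 2 K)).

HB.instance Definition _ := GRing.RMorphism.copy affine_inverse
  (horner_eval (b^-1 *: ('X_ord0 - a%:MP)) \o
  map_poly (horner_eval (e^-1 *: ('X_(inord 1) - c%:MP)) \o map_poly (@mpolyC 2 K))).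

Lemma affine_inverseX : affine_inverse 'X = b^-1 *: ('X_ord0 - a%:MP).
Proof. by rewrite /affine_inverse /= map_polyX /horner_eval hornerX. Qed.

Lemma affine_inverseC (p : {poly K}) : affine_inverse p%:P =
  (map_poly (@mpolyC 2 K) p).[e^-1 *: ('X_(inord 1) - c%:MP)].
Proof. by rewrite /affine_inverse /= map_polyC /horner_eval hornerC. Qed.

Lemma affine_inverseCC (k : K) : affine_inverse k%:P%:P = k%:MP.
Proof. by rewrite affine_inverseC map_polyC hornerC. Qed.

Lemma affine_inverseY (r t : K) : affine_inverse (r *: 'X + t%:P)%:P =
  (r / e) *: 'X_(inord 1) + (t - r / e * c)%:MP.
Proof.
rewrite affine_inverseC rmorphD /= map_polyZ map_polyX map_polyC /=.
rewrite hornerD hornerZ hornerX hornerC.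
rewrite mul_mpolyC scalerA scalerBr -addrA; congr (_ + _).
by rewrite -mul_mpolyC -mpolyCM -mpolyCN -mpolyCD addrC.
Qed.

Lemma pullbackK : cancel pullback affine_inverse.
Proof.
move=> f; rewrite pullbackE rmorph_sum [RHS]mpolyE; apply: eq_bigr => m _.
rewrite !rmorphM !rmorphXn /= affine_inverseCC mul_mpolyC; congr (_ *: _).
have -> : affine_inverse (affine_coord ord0) = 'X_ord0.
  rewrite /affine_coord eqxx rmorphD rmorphM /= !affine_inverseCC affine_inverseX.
  by rewrite mul_mpolyC scalerA mulfV // scale1r subrK.
have -> : affine_inverse (affine_coord (inord 1)) = 'X_(inord 1).
  rewrite /affine_coord -val_eqE /= inordK // affine_inverseY.
  by rewrite mulfV // scale1r mul1r subrr mpolyC0 addr0.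
rewrite [RHS]mpolyXE_id !big_ord_recl big_ord0 mulr1; congr (_ * 'X__ ^+ m _).
all: by apply: val_inj; rewrite /= inordK.
Qed.

(** A factor [line r s t] goes back to a factor of f with linear coefficients r / b and s / e, which
    has degree exactly 1 unless r = s = 0. *)
Lemma pullback_line_free f : ~ has_linear_factor f -> line_free (pullback f).
Proof.
move=> nolin r s t H def_f; have [rs0|rs_nz] := boolP ((r == 0) && (s == 0)).
  by case/andP: rs0 => /eqP-> /eqP->.
case: nolin; exists (affine_inverse (line r s t)), (affine_inverse H); split; last first.
  by rewrite -rmorphM /= -def_f pullbackK.
rewrite /has_degree /line rmorphD /= affine_inverseY -mul_polyC rmorphM /=.
rewrite affine_inverseCC affine_inverseX mul_mpolyC scalerA scalerBr.
rewrite [X in msize X](_ : _ = (r / b) *: 'X_ord0 + (s / e) *: 'X_(inord 1)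
           + (t - s / e * c - r / b * a)%:MP); last first.
  rewrite -[(r / b) *: a%:MP]mul_mpolyC -mpolyCM !mpolyCB addrACA.
  by congr (_ + _); rewrite addrC.
apply: msize_linear; rewrite !mulf_eq0 !invr_eq0 (negPf b_nz) (negPf e_nz) !orbF.
by rewrite -negb_and.
Qed.

End Pullback.
End AffinePullback.

(* Arbitrary grids and the real exponent *)
From mathcomp Require Import finmap complex reals exp.
From mathcomp Require mpoly.
Import AffinePullback.

Lemma arith_prog_step (R : nzRingType) k (a b b' x : R) :
    (0 < k)%N -> (b != 0 -> b' = b) -> x \in arith_prog k a b ->
  exists i : 'I_k, x = a + b' * i%:R.
Proof.
move=> k_gt0 def_b' /imfsetP[j /=]; rewrite mem_iota add0n => /= ltjk ->.
(* With step zero the only point is a, which has index 0 for any replacement step. *)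
have [->|b_nz] := eqVneq b 0; first by exists (Ordinal k_gt0); rewrite !mulr0.
by exists (Ordinal ltjk); rewrite def_b' // mulr_natl mulr_natr.
Qed.

(** Replacing a zero step by 1 only enlarges the grid and makes the affine map invertible. *)
Lemma curve_points_card (K : closedFieldType) (f : mpoly.mpoly 2 K) k (a b c e : K) :
    (0 < k)%N ->
  exists b' e', [/\ b' != 0, e' != 0 &
   (#|` curve_points f (grid k a b c e)| <= #|lattice_zeros k (pullback a b' c e' f)|)%N].
Proof.
move=> k_gt0; pose nz (u : K) := if u == 0 then 1 else u.
have nz_neq0 u : nz u != 0 by rewrite /nz; have [_|//] := eqVneq u 0; rewrite oner_eq0.
have nzE u : u != 0 -> nz u = u by rewrite /nz => /negPf->.
exists (nz b), (nz e); split=> //; set S := lattice_zeros _ _.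
pose g (P : 'I_k * 'I_k) := (a + nz b * P.1%:R, c + nz e * P.2%:R).
rewrite [leqRHS]cardE -(size_map g); apply: uniq_leq_size (fset_uniq _) _ => -[x y].
rewrite !inE /= => /andP[/andP[xP yP] fxy].
have [i def_x] := arith_prog_step k_gt0 (nzE b) xP.
have [j def_y] := arith_prog_step k_gt0 (nzE e) yP.
apply/mapP; exists (i, j); last by rewrite /g def_x def_y.
by rewrite mem_enum inE /= horner_pullback -def_x -def_y.
Qed.

(** Both sides are cubed; then C <= (C + 1)^3 suffices. *)
Lemma powR_two_thirds_bound (R : realType) N C k :
  (N ^ 3 <= C * k ^ 2)%N -> (N%:R : R) <= C.+1%:R * k%:R `^ (2 / 3).
Proof.
move=> le_N; rewrite -(@ler_pXn2r _ 3) ?nnegrE ?mulr_ge0 ?ler0n ?powR_ge0 //.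
rewrite exprMn -[X in _ * X]powR_mulrn ?powR_ge0 // -powRrM.
rewrite -[2 / 3 * 3%:R]mulrA mulVf ?pnatr_eq0 // mulr1 powR_mulrn ?ler0n //.
rewrite -!natrX -natrM ler_nat; apply: leq_trans le_N _; rewrite leq_mul2r.
by rewrite expnS (leq_trans (leqnSn C)) ?orbT // leq_pmulr ?expn_gt0.
Qed.

Theorem theorem11 (R : realType) (d : nat) (hd : (2 <= d)%N) :
  exists C : R,
    forall f : mpoly.mpoly 2 R[i],
      has_degree f d ->
      ~ has_linear_factor f ->
      forall (k : nat) (a b c e : R[i]),
        (0 < k)%N ->
        (#|` curve_points f (grid k a b c e) |%:R : R) <= C * k%:R `^ (2 / 3).
Proof.
(* Both sizes of the pullback are at most [msize f], that is d + 1, whatever the grid; hence the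
   constant depends on d alone. *)
have [C zerosC] := @lattice_zeros_card R[i] (d.+1 + d.+1).
exists C.+1%:R => f deg_f nolin k a b c e k_gt0.
have [b' [e' [b'_nz e'_nz le_card]]] := curve_points_card f a b c e k_gt0.
apply: powR_two_thirds_bound.
have szF : (size (pullback a b' c e' f) + sizeY (pullback a b' c e' f) <= d.+1 + d.+1)%N.
  by rewrite -deg_f leq_add ?size_pullback ?sizeY_pullback.
have lfF := @pullback_line_free _ a b' c e' b'_nz e'_nz f nolin.
by apply: leq_trans (zerosC _ lfF szF _ k_gt0); rewrite leq_exp2r.
Qed.
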